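(* Let $n \geq 4$ be an even integer and $d \geq 2$ an integer. Then Player $B$ has a winning strategy in the game $Z(n,d)$.
   Context: For integers $n \geq 4$ and $d \geq 2$, $Z(n,d)$ is the following two-player game. Initially the board contains the numbers $1,2,\dots,n$. Players $A$ and $B$ alternately cross out (remove) one number from the board, with $A$ moving first, until exactly two numbers remain. If the sum of the two remaining numbers is divisible by $d$, $A$ wins; otherwise $B$ wins. A player has a winning strategy if that player can force a win regardless of the opponent's moves. *)

(* Defs.v *)
From mathcomp Require Import all_boot.

Set Implicit Arguments.
Unset Strict Implicit.
Unset Printing Implicit Defensive.

Inductive player := PlayerA | PlayerB.

(* A history is the sequence of crossed-out numbers, oldest first. *)
Definition board (n : nat) (h : seq nat) : seq nat :=
  [seq x <- iota 1 n | x \notin h].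

Definition turn (h : seq nat) : player :=
  if odd (size h) then PlayerB else PlayerA.

Definition legal (n : nat) (h : seq nat) : Prop :=
  forall q x, prefix (rcons q x) h -> 2 < size (board n q) /\ x \in board n q.

Definition finished (n : nat) (h : seq nat) : Prop := size (board n h) = 2.

(* Only meaningful when [h] is finished. *)
Definition winner (n d : nat) (h : seq nat) : player :=
  if d %| sumn (board n h) then PlayerA else PlayerB.

Definition strategy := seq nat -> nat.

Definition follows (P : player) (s : strategy) (h : seq nat) : Prop :=
  forall q x, prefix (rcons q x) h -> turn q = P -> x = s q.

(* The first clause makes [s] always supply a legal move, so that the second
   one is not satisfied vacuously; plays last exactly [n - 2] moves, so
   following [s] forces a finished position. *)
Definition winning_strategy (n d : nat) (P : player) (s : strategy) : Prop :=
  forall h, legal n h -> follows P s h ->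
    (~ finished n h -> turn h = P -> s h \in board n h) /\
    (finished n h -> winner n d h = P).

Definition has_winning_strategy (n d : nat) (P : player) : Prop :=
  exists s, winning_strategy n d P s.

(* Main.v *)
Require Import Defs.
From mathcomp Require Import all_boot zify.

(** Player B pairs the numbers as (1,2), (3,4), ..., (n-1,n) and answers every
    move of A with the partner of the number just removed.  When three numbers
    remain, two of them are partners b, b+1, so the sums of the remaining pairs
    obtained by removing b and b+1 differ by 1 and [d >= 2] cannot divide both.
    B's last move removes one for which divisibility fails. *)

Definition partner (x : nat) : nat := if odd x then x.+1 else x.-1.

(** On B's turn the history ends with A's move, so the default of [last] is not reached; that of
    [head] is excluded by [pairing_strategy_last]. *)
Definition pairing_strategy (n d : nat) : strategy := fun h =>
  let b := board n h in
  if size b == 3 then head 0 [seq z <- b | ~~ (d %| sumn b - z)]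
  else partner (last 0 h).

Lemma mem_board n h x : (x \in board n h) = (x \notin h) && (0 < x <= n).
Proof. by rewrite mem_filter mem_iota add1n ltnS. Qed.

Lemma mem_board_rcons n h x z :
  (z \in board n (rcons h x)) = (z != x) && (z \in board n h).
Proof. by rewrite !mem_board mem_rcons inE negb_or -!andbA. Qed.

Lemma board_rcons n h x : board n (rcons h x) = rem x (board n h).
Proof.
rewrite rem_filter ?filter_uniq ?iota_uniq // /board -filter_predI.
by apply: eq_filter => z /=; rewrite mem_rcons inE negb_or.
Qed.

Lemma size_board_rcons n h x :
  x \in board n h -> size (board n h) = (size (board n (rcons h x))).+1.
Proof. by move=> xb; rewrite board_rcons (perm_size (perm_to_rem xb)). Qed.

Lemma sumn_board_rcons n h x :
  x \in board n h -> sumn (board n (rcons h x)) = sumn (board n h) - x.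
Proof.
by move=> xb; rewrite board_rcons (perm_sumn (perm_to_rem xb)) /= addKn.
Qed.

Lemma leq_sumn_mem (s : seq nat) x : x \in s -> x <= sumn s.
Proof. by move=> xs; rewrite (perm_sumn (perm_to_rem xs)) leq_addr. Qed.

Lemma legal_rcons n h x : legal n (rcons h x) ->
  [/\ legal n h, 2 < size (board n h) & x \in board n h].
Proof.
move=> lh; have [] := lh h x (prefix_refl _); split=> // q y qh.
exact/lh/(prefix_trans qh)/prefix_rcons.
Qed.

Lemma follows_rcons P s h x : follows P s (rcons h x) ->
  follows P s h /\ (turn h = P -> x = s h).
Proof.
move=> fh; split; last exact: fh (prefix_refl _).
by move=> q y qh; apply/fh/(prefix_trans qh)/prefix_rcons.
Qed.

(** Lets [lia] pass between the number of moves, its parity and the size of the board. *)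
Lemma size_board_legal n h : legal n h -> size (board n h) + size h = n.
Proof.
elim/last_ind: h => [|h x IH].
  by move=> _; rewrite /board filter_predT size_iota addn0.
case/legal_rcons=> lh _ xb.
by rewrite -[RHS](IH lh) (size_board_rcons _ _ _ xb) size_rcons; lia.
Qed.

Lemma partner_neq x : 0 < x -> partner x != x.
Proof. by rewrite /partner; case: ifP; lia. Qed.

Lemma partnerK x : 0 < x -> partner (partner x) = x.
Proof. by case: x => //= x _; rewrite /partner /=; case ox: (odd x); rewrite /= ?ox. Qed.

(** Since [n] is even, an odd [x <= n] is below [n], so [x.+1] is still in range. *)
Lemma partner_range n x :
  ~~ odd n -> 0 < x <= n -> 0 < partner x <= n.
Proof. by rewrite /partner; case: ifP; lia. Qed.

Lemma board_gt0 {n h x} : x \in board n h -> 0 < x.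
Proof. by rewrite mem_board => /and3P[]. Qed.

(** With A to move and at least four numbers left, every earlier reply of B faced at least five
    numbers, hence was a partner move: each round removed a whole pair. *)
Lemma partner_in_board n d h : ~~ odd n -> legal n h ->
  follows PlayerB (pairing_strategy n d) h -> ~~ odd (size h) ->
  size h + 4 <= n ->
  forall z, z \in board n h -> partner z \in board n h.
Proof.
(* Induction on a bound for the length, because each step strips a round of two moves. *)
move=> n_even; have [m] := ubnP (size h); elim: m h => // m IH h.
case/lastP: h => [|h y].
  by move=> _ _ _ _ _ z; rewrite !mem_board; apply: partner_range.
case/lastP: h => [//|h x]; rewrite !size_rcons => hm.
case/legal_rcons=> lhx _ yb; have szhx := size_board_legal _ _ lhx.
case/legal_rcons: lhx => lh _ xb.
case/follows_rcons=> /follows_rcons[fh _] yE /= ho hn z.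
rewrite size_rcons in szhx.
have {}yE : y = partner x.
  rewrite yE; last by rewrite /turn size_rcons /=; case: (odd _) ho.
  rewrite /pairing_strategy last_rcons.
  (* Three numbers here would leave only two after [y], against the bound [hn]. *)
  by case: eqP => // E; exfalso; lia.
rewrite !mem_board_rcons => /and3P[zy zx zb].
have pz : partner z \in board n h by apply: (IH h) => //; lia.
rewrite pz andbT; apply/andP; split.
  apply: contra zx => /eqP E.
  by rewrite -(partnerK z) ?(board_gt0 zb) // E yE partnerK ?(board_gt0 xb).
apply: contra zy => /eqP E.
by rewrite yE -E partnerK ?(board_gt0 zb).
Qed.

(** Before A removed [x], two whole pairs were left. Any survivor other than [partner x] lies in the
    pair that A did not break. *)
Lemma partners_remain n d p x : ~~ odd n -> legal n (rcons p x) ->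
  follows PlayerB (pairing_strategy n d) (rcons p x) -> ~~ odd (size p) ->
  size (board n (rcons p x)) = 3 ->
  exists2 b, b \in board n (rcons p x) & partner b \in board n (rcons p x).
Proof.
move=> n_even lq /follows_rcons[fp _] ev s3.
have szq := size_board_legal _ _ lq.
case/legal_rcons: lq => lp _ xb.
rewrite s3 size_rcons in szq.
have pin z : z \in board n p -> partner z \in board n p.
  by apply: (partner_in_board n d) => //; lia.
have: has [pred b | b != partner x] (board n (rcons p x)).
  apply/negPn/negP; rewrite -all_predC => /allP allx.
  have uq : uniq (board n (rcons p x)) by rewrite filter_uniq ?iota_uniq.
  suff: size (board n (rcons p x)) <= size [:: partner x] by rewrite s3.
  apply: uniq_leq_size => // b /allx /=.
  by rewrite negbK inE.
case/hasP=> b bq /= bx; exists b => //.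
move: bq; rewrite !mem_board_rcons => /andP[_ bp].
rewrite pin // andbT; apply: contra bx => /eqP <-.
by rewrite partnerK ?(board_gt0 bp).
Qed.

(** Otherwise [d] would divide two consecutive numbers, hence 1. *)
Lemma partners_separate d (s : seq nat) b : 1 < d -> 0 < b ->
  b \in s -> partner b \in s ->
  has [pred z | ~~ (d %| sumn s - z)] s.
Proof.
move=> d1 b0 bs pbs; apply/negPn/negP; rewrite -all_predC => /allP alls.
have /negPn db := alls _ bs; have /negPn dpb := alls _ pbs.
(* These bounds keep the truncated subtractions exact. *)
have le1 := leq_sumn_mem _ _ bs; have le2 := leq_sumn_mem _ _ pbs.
suff: d %| 1 by rewrite dvdn1; lia.
move: pbs dpb le2; rewrite /partner; case: ifP => _ _ dpb le2.
  by rewrite -(dvdn_addr _ dpb) (_ : _ + 1 = sumn s - b) //; lia.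
by rewrite -(dvdn_addr _ db) (_ : _ + 1 = sumn s - b.-1) //; lia.
Qed.

Lemma pairing_strategy_last n d q : ~~ odd n -> 1 < d -> legal n q ->
  follows PlayerB (pairing_strategy n d) q -> odd (size q) ->
  size (board n q) = 3 ->
  (pairing_strategy n d q \in board n q) &&
  ~~ (d %| sumn (board n q) - pairing_strategy n d q).
Proof.
case/lastP: q => [//|p x] n_even d1 lq fq; rewrite size_rcons /= => ev s3.
have [b bq pbq] := partners_remain n d p x n_even lq fq ev s3.
have := partners_separate d _ b d1 (board_gt0 bq) bq pbq.
rewrite /pairing_strategy s3 /= has_filter.
set t := filter _ _ => tN.
have : head 0 t \in t by case: t tN => //= a t _; rewrite mem_head.
by rewrite mem_filter andbC.
Qed.

Theorem theorem3p2p5 (n d : nat) (hn : 4 <= n) (hn_even : ~~ odd n) (hd : 2 <= d) :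
  has_winning_strategy n d PlayerB.
Proof.
exists (pairing_strategy n d) => h lh fh; have szh := size_board_legal _ _ lh.
split.
  move=> nfin; rewrite /turn; case: ifP => // oh _.
  have [s3|s3] := eqVneq (size (board n h)) 3.
    by have /andP[] := pairing_strategy_last n d h hn_even hd lh fh oh s3.
  case/lastP: h oh lh fh szh nfin s3 => [//|p x].
  rewrite size_rcons /finished => ev lq /follows_rcons[fp _] szh nfin s3.
  case/legal_rcons: lq => lp sp xb.
  have szp := size_board_rcons _ _ _ xb.
  have pin : partner x \in board n p.
    (* The board after [x] has neither two nor three numbers, so at least four, and [p] satisfies
       the length bound. *)
    by apply: (partner_in_board n d) => //; lia.
  rewrite /pairing_strategy (negbTE s3) last_rcons mem_board_rcons pin andbT.
  exact/partner_neq/(board_gt0 xb).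
rewrite /finished /winner => fin.
case/lastP: h lh fh szh fin => [|q z].
  by move=> _ _ szh fin; rewrite fin /= in szh; lia.
rewrite size_rcons => lh /follows_rcons[fq zE] szh fin.
case/legal_rcons: lh => lq _ zb.
have s3 : size (board n q) = 3 by rewrite (size_board_rcons _ _ _ zb) fin.
(* Three numbers left out of an even [n]: the last move [z] is B's. *)
have oq : odd (size q) by lia.
have /andP[_] := pairing_strategy_last n d q hn_even hd lq fq oq s3.
by rewrite -zE ?/turn ?oq // -sumn_board_rcons // => /negbTE ->.
Qed.
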